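(* Let $d\ge1$ be an integer. For every bounded linear operator $\mathcal A:C(\mathbb S^d)\to C(\mathbb S^d)$ with $\mathcal A1=1$, \[ \|\mathcal A\|_{C(\mathbb S^d)\to C(\mathbb S^d)}=1+2\mathfrak p(\mathcal A). \] Moreover, \[ \mathfrak p(\mathcal A)=\sup_{x\in\mathbb S^d,\ f\in C(\mathbb S^d),\ 0\le f\le1}\bigl(\mathcal Af(x)-1\bigr)=\sup_{x\in\mathbb S^d,\ f\in C(\mathbb S^d),\ 0\le f\le1}\bigl(-\mathcal Af(x)\bigr). \] In particular, $\|\mathcal A\|\ge1$, with equality if and only if $\mathcal A$ is positive.
   Context: $\mathbb S^d\subset\mathbb R^{d+1}$ is the unit sphere and $C(\mathbb S^d)$ is the real Banach space of continuous real-valued functions on $\mathbb S^d$ with the uniform norm. An operator $\mathcal A$ is positive if $\mathcal Af\ge0$ whenever $f\ge0$. For a bounded operator $\mathcal A:C(\mathbb S^d)\to C(\mathbb S^d)$ with $\mathcal A1=1$, for each $x\in\mathbb S^d$ let $\mu_x^{\mathcal A}$ be the unique finite signed regular Borel measure (given by the Riesz--Markov theorem) with $\mathcal Af(x)=\int_{\mathbb S^d}f\,\mathrm d\mu_x^{\mathcal A}$ for all $f\in C(\mathbb S^d)$, with Jordan decomposition $\mu_x^{\mathcal A}=\mu_{x,+}^{\mathcal A}-\mu_{x,-}^{\mathcal A}$. The positivity loss of $\mathcal A$ is $\mathfrak p(\mathcal A):=\sup_{x\in\mathbb S^d}\mu_{x,-}^{\mathcal A}(\mathbb S^d)$. *)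

(* Defs.v *)
From HB Require Import structures.
From mathcomp Require Import all_boot all_order all_algebra.
From mathcomp Require Import all_classical all_reals all_analysis.

Set Implicit Arguments.
Unset Strict Implicit.
Unset Printing Implicit Defensive.

Import Order.TTheory GRing.Theory Num.Theory.
Import numFieldNormedType.Exports.

Local Open Scope classical_set_scope.
Local Open Scope ring_scope.

(* The library norm on row vectors is the max norm, so the Euclidean sphere is
   given by its equation; the max norm and the Euclidean norm induce the same
   topology. *)
Definition sphere_set (R : realType) (d : nat) : set 'rV[R]_d.+1 :=
  [set x | \sum_(i < d.+1) x ord0 i ^+ 2 = 1].

Definition sphere (R : realType) (d : nat) : Type := set_type (@sphere_set R d).

HB.instance Definition _ (R : realType) (d : nat) :=
  PseudoMetric.copy (sphere R d) (set_type (@sphere_set R d)).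

Section sphere_theory.
Variables (R : realType) (d : nat).

Lemma sphere_pole : (delta_mx ord0 ord0 : 'rV[R]_d.+1) \in @sphere_set R d.
Proof.
rewrite inE /sphere_set /= (bigD1 ord0) //= big1 => [|i i0].
  by rewrite addr0 mxE !eqxx expr1n.
by rewrite mxE (negbTE i0) andbF expr0n.
Qed.

HB.instance Definition _ := isPointed.Build (sphere R d)
  (SigSub sphere_pole : sphere R d).

Lemma sphere_set_compact : compact (@sphere_set R d).
Proof.
apply: bounded_closed_compact.
  exists 1; split => // M M1 x /= Sx.
  apply: le_trans (ltW M1).
  rewrite /Num.norm /= mx_normrE bigmax_le// => -[i j] _ /=.
  rewrite (ord1 i) -(@ler_pXn2r _ 2)// ?nnegrE// expr1n real_normK ?num_real//.
  rewrite -Sx (bigD1 j)//= lerDl sumr_ge0// => k _; exact: sqr_ge0.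
rewrite (_ : sphere_set (d := d) =
  (fun x : 'rV[R]_d.+1 => \sum_(i < d.+1) x ord0 i ^+ 2) @^-1` [set 1])//.
have sqc (i : 'I_d.+1) : continuous (fun x : 'rV[R]_d.+1 => x ord0 i ^+ 2).
  move=> x; apply: (@continuous_comp _ _ _ (fun x : 'rV[R]_d.+1 => x ord0 i)
    (fun y : R => y ^+ 2)); first exact: coord_continuous.
  exact: exprn_continuous.
apply: preimage_closed; last exact: closed_eq.
move=> x _; rewrite /prop_for /continuous_at.
have addc := @add_continuous R.
exact: (continuous_big addc (fun i _ => sqc i)).
Qed.

Lemma sphere_compact : compact [set: sphere R d].
Proof.
have cid : {within @sphere_set R d, continuous
    (valL_ point (idfun : @sphere_set R d -> sphere R d))}.
  by apply/subspace_valL_continuousP' => x; exact: cvg_id.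
have := continuous_compact cid sphere_set_compact.
congr compact; apply/seteqP; split => // x _.
exists (\val x); first exact: set_valP.
exact: (congr1 (@^~ x) (valLK (point : sphere R d)
  (idfun : @sphere_set R d -> sphere R d))).
Qed.

End sphere_theory.

Definition csphere (R : realType) (d : nat) : Type :=
  continuousType (sphere R d) R.

Section csphere_theory.
Variables (R : realType) (d : nat).
Implicit Types f g : csphere R d.

HB.instance Definition _ := Choice.copy (csphere R d)
  (continuousType (sphere R d) R).

Definition csphere_of (h : sphere R d -> R) (ch : continuous h) : csphere R d :=
  mkcts ch.

Lemma csphereP f g : f = g <-> f =1 g.
Proof. exact: continuousEP. Qed.

Lemma csphere_continuous f : continuous (f : sphere R d -> R).
Proof. exact: (@cts_fun _ _ f). Qed.

Lemma csphere_add_continuous f g : continuous (fun x => f x + g x).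
Proof. by move=> x; exact: (cvgD (@csphere_continuous f x) (@csphere_continuous g x)). Qed.

Lemma csphere_opp_continuous f : continuous (fun x => - f x).
Proof. by move=> x; exact: (cvgN (@csphere_continuous f x)). Qed.

Lemma csphere_scale_continuous (a : R) f : continuous (fun x => a * f x).
Proof. by move=> x; exact: (cvgM (cvg_cst a) (@csphere_continuous f x)). Qed.

Definition csphere_cst (a : R) : csphere R d := csphere_of (@cst_continuous _ _ a).
Definition csphere_add f g := csphere_of (@csphere_add_continuous f g).
Definition csphere_opp f := csphere_of (@csphere_opp_continuous f).
Definition csphere_scale a f := csphere_of (@csphere_scale_continuous a f).

Let addA : associative csphere_add.
Proof. by move=> f g h; apply/csphereP => x; exact: addrA. Qed.
Let addC : commutative csphere_add.
Proof. by move=> f g; apply/csphereP => x; exact: addrC. Qed.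
Let add0 : left_id (csphere_cst 0) csphere_add.
Proof. by move=> f; apply/csphereP => x; exact: add0r. Qed.
Let addN : left_inverse (csphere_cst 0) csphere_opp csphere_add.
Proof. by move=> f; apply/csphereP => x; exact: addNr. Qed.

HB.instance Definition _ := GRing.isZmodule.Build (csphere R d)
  addA addC add0 addN.

Let scaleA (a b : R) f :
  csphere_scale a (csphere_scale b f) = csphere_scale (a * b) f.
Proof. by apply/csphereP => x; exact: mulrA. Qed.
Let scale1 : left_id 1 csphere_scale.
Proof. by move=> f; apply/csphereP => x; exact: mul1r. Qed.
Let scaleDr : right_distributive csphere_scale +%R.
Proof. by move=> a f g; apply/csphereP => x; exact: mulrDr. Qed.
Let scaleDl f : {morph csphere_scale^~ f : a b / a + b}.
Proof. by move=> a b; apply/csphereP => x; exact: mulrDl. Qed.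

HB.instance Definition _ := GRing.Zmodule_isLmodule.Build R (csphere R d)
  scaleA scale1 scaleDr scaleDl.

Lemma csphere_cstE (a : R) x : csphere_cst a x = a. Proof. by []. Qed.
Lemma csphere_addE f g x : (f + g) x = f x + g x. Proof. by []. Qed.
Lemma csphere_oppE f x : (- f) x = - f x. Proof. by []. Qed.
Lemma csphere_scaleE (a : R) f x : (a *: f) x = a * f x. Proof. by []. Qed.

Definition csphere_norm f : R := sup (range (fun x => `|f x|)).

Lemma csphere_norm_has_sup f : has_sup (range (fun x => `|f x|)).
Proof.
have cf : continuous (fun x : sphere R d => `|f x|).
  by move=> x; exact: (cvg_norm (@csphere_continuous f x)).
apply: compact_has_sup; first by exists `|f point|, point.
apply: continuous_compact; last exact: sphere_compact.
exact: continuous_subspaceT.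
Qed.

Lemma csphere_norm_ub f x : `|f x| <= csphere_norm f.
Proof. by apply: sup_upper_bound; [exact: csphere_norm_has_sup|exists x]. Qed.

Lemma csphere_norm_le f (M : R) :
  (forall x, `|f x| <= M) -> csphere_norm f <= M.
Proof.
move=> fM; apply: ge_sup; first by exists `|f point|, point.
by move=> _ [x _ <-]; exact: fM.
Qed.

Let normD f g : csphere_norm (f + g) <= csphere_norm f + csphere_norm g.
Proof.
apply: csphere_norm_le => x; rewrite csphere_addE (le_trans (ler_normD _ _))//.
by rewrite lerD// csphere_norm_ub.
Qed.

Let normZ (a : R) f : csphere_norm (a *: f) = `|a| * csphere_norm f.
Proof.
have le (b : R) g : csphere_norm (b *: g) <= `|b| * csphere_norm g.
  apply: csphere_norm_le => x; rewrite csphere_scaleE normrM.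
  by rewrite ler_wpM2l// csphere_norm_ub.
apply/eqP; rewrite eq_le le /=; have [->|a0] := eqVneq a 0.
  by rewrite normr0 mul0r (le_trans (normr_ge0 _) (csphere_norm_ub _ point)).
rewrite -ler_pdivlMl ?normr_gt0// -normfV.
by rewrite -{1}[f]scale1r -(mulVf a0) -scalerA le.
Qed.

Let norm0_eq0 f : csphere_norm f = 0 -> f = 0.
Proof.
move=> f0; apply/csphereP => x; apply/normr0_eq0/eqP.
by rewrite eq_le normr_ge0 andbT -f0 csphere_norm_ub.
Qed.

HB.instance Definition _ := Lmodule_isNormed.Build R (csphere R d)
  normD normZ norm0_eq0.

Lemma csphere_normE f : `|f| = sup (range (fun x => `|f x|)).
Proof. by []. Qed.

End csphere_theory.

Section bounded_operator.
Variables (R : realType) (V : normedModType R).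
Implicit Types A : {linear V -> V}.

Definition bounded_operator A : Prop := exists M : R, forall f, `|A f| <= M * `|f|.

Definition opnorm A : \bar R := ereal_sup [set `|A f|%:E | f in [set f | `|f| <= 1]].

End bounded_operator.

Section positive_operator.
Variables (R : realType) (d : nat).

Definition positive_operator (A : {linear csphere R d -> csphere R d}) : Prop :=
  forall f : csphere R d, (forall x, 0 <= f x) -> forall x, 0 <= A f x.

End positive_operator.

Section charge_choice.
Context d (T : measurableType d) (R : realType).

HB.instance Definition _ := gen_eqMixin (charge T R).
HB.instance Definition _ := gen_choiceMixin (charge T R).

End charge_choice.

Section jordan.
Local Open Scope ereal_scope.
Context d (T : measurableType d) (R : realType).
Implicit Types nu : {charge set T -> \bar R}.

Lemma hahn_ex nu : exists PN : set T * set T, hahn_decomposition nu PN.1 PN.2.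
Proof. by have [P [N PN]] := Hahn_decomposition nu; exists (P, N). Qed.

(* The Hahn decomposition is only unique up to null sets, but the two measures
   below do not depend on it. *)
Definition hahn_choice nu := projT2 (cid (hahn_ex nu)).

Definition jordan_plus nu : {finite_measure set T -> \bar R} :=
  jordan_pos (hahn_choice nu).
Definition jordan_minus nu : {finite_measure set T -> \bar R} :=
  jordan_neg (hahn_choice nu).
Definition charge_total_variation nu : set T -> \bar R := charge_variation (hahn_choice nu).

Definition charge_integral nu (f : T -> R) : \bar R :=
  \int[jordan_plus nu]_x (f x)%:E - \int[jordan_minus nu]_x (f x)%:E.

End jordan.

Section regular.
Variables (R : realType).
Local Open Scope ereal_scope.

(* A signed measure is regular when its total variation is. *)
Definition regular_charge (X : ptopologicalType)
    (nu : {charge set (g_sigma_algebraType (@open X)) -> \bar R}) : Prop :=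
  forall B : set X, (@open X).-sigma.-measurable B ->
    charge_total_variation nu B = ereal_inf
      [set charge_total_variation nu U | U in [set U : set X | open U /\ B `<=` U]] /\
    charge_total_variation nu B = ereal_sup
      [set charge_total_variation nu K | K in [set K : set X | compact K /\ K `<=` B]].

End regular.

Section positivity_loss.
Local Open Scope ereal_scope.
Variables (R : realType) (d : nat).

Definition borel_sphere := g_sigma_algebraType (@open (sphere R d)).

Definition represents (L : csphere R d -> R)
    (nu : {charge set borel_sphere -> \bar R}) : Prop :=
  regular_charge nu /\ forall f, (L f)%:E = charge_integral nu f.

(* A charge is a total function on sets, so only its values on Borel sets are
   relevant. By the Riesz-Markov theorem a representing charge exists, with
   unique values on Borel sets, as soon as A is bounded; the default value
   czero is then never used. *)
Definition riesz_charge (A : {linear csphere R d -> csphere R d})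
    (x : sphere R d) : {charge set borel_sphere -> \bar R} :=
  @xget (charge borel_sphere R) czero [set nu | represents (fun f => A f x) nu].

Definition positivity_loss (A : {linear csphere R d -> csphere R d}) : \bar R :=
  ereal_sup (range (fun x => jordan_minus (riesz_charge A x) [set: borel_sphere])).

End positivity_loss.

(* Main.v *)
(* For each x the functional f |-> A f x is represented by a signed measure nu,
   obtained from Riesz's formula L^+ f = sup {L g | 0 <= g <= f} for the positive
   part of a bounded functional L and from the outer measure
   E |-> inf_(U open, E in U) sup {p f | f <= 1_U} of a positive functional p.
   The negative part of nu has total mass sup {- A f x | 0 <= f <= 1}: the
   indicator of the negative Hahn set is approximated by continuous functions
   thanks to regularity. The substitutions f -> 1 - f and g = 1 - 2 f then give
   the other supremum and the operator norm. *)
Require Import Defs.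
From HB Require Import structures.
From mathcomp Require Import all_boot all_order all_algebra.
From mathcomp Require Import all_classical all_reals all_analysis.
From mathcomp Require Import measurable_realfun ring lra.

Set Implicit Arguments.
Unset Strict Implicit.
Unset Printing Implicit Defensive.

Import Order.TTheory GRing.Theory Num.Theory.
Import numFieldNormedType.Exports.

Local Open Scope classical_set_scope.
Local Open Scope ring_scope.

(** [riesz_charge] is picked by [xget] and known only through [represents], so the loss at [x] must
    be computed from regularity and the integral formula alone. Regularity speaks of the total
    variation of [nu], built on an abstractly chosen Hahn decomposition, while the construction
    yields [nu = m1 - m2] with [m1] and [m2] outer regular; minimality of the Jordan decomposition
    bridges the two. The theorem on positive functionals is applied twice, to L^+ and to L^- = L^+ -
    L. Since L^+ is additive and homogeneous only on nonnegative functions, it is stated for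
    functionals controlled there only, and the general integrand is recovered by adding a
    constant. *)

Local Notation borel T := (g_sigma_algebraType (@open T)).

(** * Continuous functions separating a closed set from the complement of an open one *)

Section bump_functions.
Context {R : realType} {T : pseudoMetricType R}.

Lemma open_cozero (U : set T) : open U -> exists phi : T -> R,
  [/\ continuous phi, forall x, 0 <= phi x <= 1 & forall x, U x <-> 0 < phi x].
Proof.
(* The distance to the complement, cut at 1: it stays finite even for [U] the whole space, where the
   infimum runs over the empty set. *)
move=> oU; pose d x : \bar R := Order.min (edist_inf (R := R) (~` U) x) 1%E.
have d0 x : (0 <= d x)%E by rewrite /d le_min edist_inf_ge0 lee01.
have d1 x : (d x <= 1)%E by rewrite /d ge_min lexx orbT.
have dfin x : d x \is a fin_num.
  by rewrite ge0_fin_numE// (le_lt_trans (d1 x))// ltry.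
have dlip x y (e : R) : 0 < e -> ball x e y -> fine (d x) <= fine (d y) + e.
  move=> e0 xy; rewrite -lee_fin EFinD !fineK// /d.
  have exy : (edist (x, y) <= e%:E)%E by rewrite edist_fin.
  have [_|_] := leP (edist_inf (~` U) y) 1%E.
    rewrite ge_min; apply/orP; left; rewrite addeC.
    exact: (le_trans (edist_inf_triangle _ _ y) (leeD2r _ exy)).
  by rewrite ge_min; apply/orP; right; rewrite leeDl// lee_fin ltW.
exists (fun x => fine (d x)); split => [x|x|x].
- apply/cvgrPdist_le => e e0; near=> y.
  have xy : ball x e y by near: y; exact: nbhsx_ballx.
  rewrite ler_norml; apply/andP; split.
    by rewrite lerBrDl lerBlDr dlip//; exact: ball_sym.
  by rewrite lerBlDl dlip.
- by rewrite -!lee_fin !fineK// d0 d1.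
- split=> [Ux|].
    have /nbhs_ballP[e /= e0 eU] : nbhs x U by exact: open_nbhs_nbhs.
    apply: fine_gt0; rewrite -ge0_fin_numE// dfin andbT.
    rewrite /d lt_min lte01 andbT (@lt_le_trans _ _ e%:E)//.
    apply: le_ereal_inf_tmp => _ [a nUa <-]; rewrite leNgt; apply/negP => xa.
    by apply: nUa; apply: eU; exact: (@edist_lt_ball R T e (x, a)).
  move=> px; apply: contrapT => nUx; move: px.
  by rewrite /d edist_inf0// min_l ?lee01// ltxx.
Unshelve. all: by end_near. Qed.

(** An explicit Urysohn function [u / (u + k)], with [u] and [k] positive exactly on [U] and off
    [K]. As [K] lies in [U], they never vanish together. *)
Lemma closed_open_bump (K U : set T) : closed K -> open U -> K `<=` U ->
  exists f : T -> R, [/\ continuous f, forall x, 0 <= f x <= 1,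
    forall x, K x -> f x = 1 & forall x, ~ U x -> f x = 0].
Proof.
move=> cK oU KU; have [u [cu u01 uU]] := open_cozero oU.
have [k [ck k01 kK]] := open_cozero (closed_openC cK).
have u0 x := andP (u01 x); have k0 x := andP (k01 x).
have uk x : 0 < u x + k x.
  have [ux _] := u0 x; have [kx _] := k0 x.
  have [Kx|nKx] := pselect (K x).
    by rewrite ltr_pwDl//; exact/uU/KU.
  by rewrite ltr_wpDl//; exact/kK.
exists (fun x => u x / (u x + k x)); split => [x|x|x Kx|x nUx].
- apply: cvgM; first exact: cu.
  by apply: cvgV; [rewrite gt_eqF|apply: cvgD; [exact: cu|exact: ck]].
- have [ux _] := u0 x; have [kx _] := k0 x.
  rewrite divr_ge0 ?addr_ge0//= ler_pdivrMr// mul1r lerDl//.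
- have -> : k x = 0.
    have [kx _] := k0 x; apply/eqP; rewrite eq_le kx andbT leNgt.
    by apply/negP => /kK; exact.
  by rewrite addr0 divff// gt_eqF//; exact/uU/KU.
- have -> : u x = 0.
    have [ux _] := u0 x; apply/eqP; rewrite eq_le ux andbT leNgt.
    by apply/negP => /uU.
  by rewrite mul0r.
Qed.

End bump_functions.

(** * Borel measurability, boundedness and integrability of continuous functions *)

Section continuous_functions_on_compact_spaces.
Context {R : realType} {T : pseudoPMetricType R}.

Lemma open_borel (U : set T) : open U -> measurable (U : set (borel T)).
Proof. exact: sub_sigma_algebra. Qed.

Lemma closed_borel (K : set T) : closed K -> measurable (K : set (borel T)).
Proof.
move=> cK; rewrite -[K]setCK; apply: measurableC; apply: open_borel.
exact: closed_openC.
Qed.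

Lemma continuous_borel (f : T -> R) : continuous f ->
  measurable_fun [set: borel T] f.
Proof.
move=> cf; apply: (measurability _ (RGenOInfty.measurableE R)).
move=> _ [_ [x ->] <-]; rewrite setTI; apply: open_borel.
by apply: open_comp; [move=> y _; exact: cf|exact: interval_open].
Qed.

Lemma continuous_borel_EFin (f : T -> R) : continuous f ->
  measurable_fun [set: borel T] (EFin \o (f : borel T -> R)).
Proof. by move=> cf; apply/measurable_EFinP; exact: continuous_borel. Qed.

Lemma compact_continuous_bounded (f : T -> R) : compact [set: T] ->
  continuous f -> exists2 M : R, 0 < M & forall x, `|f x| <= M.
Proof.
move=> cT cf; have cfT : compact (f @` [set: T]).
  by apply: continuous_compact => //; exact: continuous_subspaceT.
have [M M0 MP] := pinfty_ex_gt0 (compact_bounded cfT).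
by exists M => // x; apply: MP; exists x.
Qed.

Lemma continuous_integrable (mu : {finite_measure set (borel T) -> \bar R})
    (f : T -> R) : compact [set: T] -> continuous f ->
  mu.-integrable [set: borel T] (EFin \o f).
Proof.
move=> cT cf; apply: measurable_bounded_integrable => //.
- by rewrite ltey_eq fin_num_measure.
- exact: continuous_borel.
have [M M0 MP] := compact_continuous_bounded cT cf.
exists M; split=> [|r Mr x _]; first exact: num_real.
exact: le_trans (MP x) (ltW Mr).
Qed.

End continuous_functions_on_compact_spaces.

(** * The Riesz-Markov theorem for positive functionals *)

Section positive_functional.
Context {R : realType} {T : pseudoPMetricType R}.
Hypothesis cT : compact [set: T].
Variable p : (T -> R) -> R.
Hypothesis pD : forall f g : T -> R, continuous f -> continuous g ->
  (forall x, 0 <= f x) -> (forall x, 0 <= g x) ->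
  p (fun x => f x + g x) = p f + p g.
Hypothesis pZ : forall (c : R) (f : T -> R), 0 <= c -> continuous f ->
  (forall x, 0 <= f x) -> p (fun x => c * f x) = c * p f.
Hypothesis p_ge0 : forall f : T -> R, continuous f -> (forall x, 0 <= f x) -> 0 <= p f.

Let cst1c : continuous (fun _ : T => 1 : R).
Proof. by move=> x; exact: cvg_cst. Qed.

Let p_cst (c : R) : 0 <= c -> p (fun=> c) = c * p (fun=> 1).
Proof.
move=> c0; rewrite -pZ//; congr p; apply/funext => x; by rewrite mulr1.
Qed.

Let le_p (f g : T -> R) : continuous f -> continuous g -> (forall x, 0 <= f x <= g x) ->
  p f <= p g.
Proof.
move=> cf cg fg; have f0 x : 0 <= f x by case/andP: (fg x).
have gf0 x : 0 <= g x - f x by rewrite subr_ge0; case/andP: (fg x).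
have cgf : continuous (fun x => g x - f x).
  by move=> x; exact: (cvgB (cg x) (cf x)).
have -> : g = fun x => f x + (g x - f x) by apply/funext => x; lra.
by rewrite pD// lerDl p_ge0.
Qed.

Let sum_continuous (n : nat) (g : nat -> T -> R) :
  (forall i, continuous (g i)) -> continuous (fun x => \sum_(i < n) g i x).
Proof.
by move=> cg; apply: (continuous_big (@add_continuous R)) => i _; exact: cg.
Qed.

Let p_sum (n : nat) (g : nat -> T -> R) : (forall i, continuous (g i)) ->
  (forall i x, 0 <= g i x) ->
  p (fun x => \sum_(i < n) g i x) = \sum_(i < n) p (g i).
Proof.
move=> cg g0; elim: n => [|n IH].
  rewrite big_ord0; under eq_fun do rewrite big_ord0.
  by rewrite p_cst// mul0r.
rewrite big_ord_recr/= -IH -pD//.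
- by congr p; apply/funext => x; rewrite big_ord_recr.
- exact: sum_continuous.
- by move=> x; rewrite sumr_ge0.
Qed.

(** Vanishing off [U] stands in for compact support inside [U]; the margin that compact support
    would give is supplied later by cutting at a small height [e']. *)
Let test (U : set T) : set (T -> R) := [set f : T -> R | [/\ continuous f,
  forall x, 0 <= f x <= 1 & forall x, ~ U x -> f x = 0]].

Let lam (U : set T) : \bar R := ereal_sup [set (p f)%:E | f in test U].

Let lam_ge0 U : (0 <= lam U)%E.
Proof.
apply: ereal_sup_ubound; exists (fun=> 0); last by rewrite p_cst// mul0r.
by split => // x; [exact: cvg_cst|rewrite lexx ler01].
Qed.

Let lam_le U V : U `<=` V -> (lam U <= lam V)%E.
Proof.
move=> UV; apply: ereal_sup_le => _ [f [cf f01 fU] <-].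
by exists f => //; split => // x nVx; apply: fU => /UV.
Qed.

Let lam_le1 U : (lam U <= (p (fun=> 1))%:E)%E.
Proof.
apply: ge_ereal_sup => _ [f [cf f01 _] <-]; rewrite lee_fin.
exact: le_p.
Qed.

(* Dini's argument: the finite sums of truncated multiples of the cozero
   functions of the [U n] eventually exceed [f - e] everywhere. *)
Let lam_bigcup (U : nat -> set T) : (forall n, open (U n)) ->
  (lam (\bigcup_n U n) <= \sum_(n <oo) lam (U n))%E.
Proof.
move=> oU; apply: ge_ereal_sup => _ [f [cf f01 fU] <-].
have [phi phiP] := choice (fun n => open_cozero (oU n)).
pose g k n x := Order.min 1 (k%:R * phi n x).
have phi0 n x : 0 <= phi n x by have [_ /(_ x)/andP[]] := phiP n.
have cg k n : continuous (g k n).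
  move=> x; apply: (@continuous_min R T (fun=> 1) (fun y => k%:R * phi n y) x).
    exact: cvg_cst.
  by apply: cvgM; [exact: cvg_cst|have [+ _ _] := phiP n; exact].
have g0 k n x : 0 <= g k n x by rewrite /g le_min ler01 mulr_ge0.
have tg k n : test (U n) (g k n).
  split=> [//|x|x nUx]; first by rewrite g0 /g ge_min lexx.
  rewrite /g; suff -> : phi n x = 0 by rewrite mulr0 min_r// ler01.
  apply/eqP; rewrite eq_le phi0 andbT leNgt; apply/negP.
  by have [_ _ /(_ x) Ux] := phiP n; move=> /Ux.
have gle k l n x : (k <= l)%N -> g k n x <= g l n x.
  move=> kl; rewrite /g le_min ge_min lexx/= ge_min; apply/orP; right.
  by rewrite ler_wpM2r// ler_nat.
have pT : 0 <= p (fun=> 1) by apply: p_ge0.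
apply/lee_addgt0Pr => e e0.
(* Chosen so that [e' * p 1 <= e]; the [+ 1] covers the case [p 1 = 0]. *)
pose e' := e / (p (fun=> 1) + 1).
have e'0 : 0 < e' by rewrite divr_gt0// ltr_wpDl.
(* A single index [k] governs both the number of terms and their slopes. Hence [V] increases with
   [k], and a finite subcover reduces to its largest index. *)
pose V k := [set x | f x < e' + \sum_(n < k) g k n x].
have oV k : open (V k).
  rewrite (_ : V k = (fun x => e' + \sum_(n < k) g k n x - f x) @^-1` [set r | 0 < r]).
    apply: open_comp; last exact: open_gt.
    move=> x _; apply: cvgB; last exact: cf.
    by apply: cvgD; [exact: cvg_cst|exact: sum_continuous].
  by apply/seteqP; split => x /=; rewrite subr_gt0.
have VS k l : (k <= l)%N -> V k `<=` V l.
  move=> kl x; rewrite /V/= => /lt_le_trans; apply; rewrite lerD2l.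
  apply: (@le_trans _ _ (\sum_(n < k) g l n x)).
    by apply: ler_sum => i _; exact: gle.
  rewrite -(subnKC kl) big_split_ord/= lerDl sumr_ge0//.
have : cover_compact [set: T] by rewrite -compact_cover.
move=> /(_ nat setT V (fun k _ => oV k))[x _|D _ DT].
  have [[n _ Unx]|nUx] := pselect ((\bigcup_n U n) x); last first.
    by exists 0%N => //; rewrite /V/= fU// big_ord0 addr0.
  have [_ _ /(_ x)[/(_ Unx) phix _]] := phiP n.
  (* Exceeding [n] puts the [n]-th term into the sum, and exceeding [1 / phi n x] brings that term
     up to 1, which dominates [f x]. *)
  pose k := (maxn n.+1 (Num.truncn (phi n x)^-1).+1).
  exists k => //; rewrite /V/=.
  have nk : (n < k)%N by rewrite /k leq_max ltnS leqnn.
  rewrite (bigD1 (Ordinal nk))//= (_ : g k n x = 1); last first.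
    rewrite /g min_l// -ler_pdivrMr// div1r.
    apply: (@le_trans _ _ (Num.truncn (phi n x)^-1).+1%:R).
      by apply/ltW; rewrite truncnS_gt.
    by rewrite ler_nat /k leq_maxr.
  have : 0 <= \sum_(i < k | i != Ordinal nk) g k i x by rewrite sumr_ge0.
  by have /andP[_] := f01 x; move: e'0; lra.
pose k := (\max_(i <- finmap.enum_fset D) i)%N.
have fk x : f x <= e' + \sum_(n < k) g k n x.
  have [i /= iD Vix] := DT x Logic.I; apply/ltW/(VS i k) => //.
  exact: leq_bigmax_seq.
have cs := @sum_continuous k _ (cg k).
have ce : continuous (fun _ : T => e' : R) by move=> x; exact: cvg_cst.
have s0 x : 0 <= \sum_(n < k) g k n x by rewrite sumr_ge0.
have pfle : p f <= e + \sum_(n < k) p (g k n).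
  apply: (@le_trans _ _ (p (fun x => e' + \sum_(n < k) g k n x))).
    apply: le_p => // [x|x]; last by have /andP[-> _] := f01 x; rewrite fk.
    by apply: cvgD; [exact: cvg_cst|exact: cs].
  rewrite pD// => [|x]; last exact: ltW.
  rewrite p_sum// lerD2r p_cst ?ltW//.
  by rewrite /e' mulrAC ltr_pdivrMr ?ltr_wpDl// ltr_pM2l// ltrDl ltr01.
rewrite addeC (@le_trans _ _ (e%:E + \sum_(n < k) lam (U n))%E)//.
  apply: (@le_trans _ _ (e + \sum_(n < k) p (g k n))%:E); first by rewrite lee_fin.
  rewrite EFinD leeD2l// -sumEFin lee_sum// => i _.
  by apply: ereal_sup_ubound; exists (g k i).
rewrite leeD2l//; have := @nneseries_lim_ge R (lam \o U) xpredT 0%N k.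
by rewrite big_mkord; apply => i _ _; exact: lam_ge0.
Qed.

Let mus (E : set T) : \bar R :=
  ereal_inf [set lam U | U in [set U | open U /\ E `<=` U]].

Let mus_open U : open U -> mus U = lam U.
Proof.
move=> oU; apply/eqP; rewrite eq_le; apply/andP; split.
  by apply: ereal_inf_lbound; exists U => //; split.
by apply: le_ereal_inf_tmp => _ [V [_ UV] <-]; exact: lam_le.
Qed.

Let mus_le_lam E U : open U -> E `<=` U -> (mus E <= lam U)%E.
Proof. by move=> oU EU; apply: ereal_inf_lbound; exists U. Qed.

Let mus_ge0 E : (0 <= mus E)%E.
Proof. by apply: le_ereal_inf_tmp => _ [U _ <-]; exact: lam_ge0. Qed.

Let mus_le1 E : (mus E <= (p (fun=> 1))%:E)%E.
Proof. exact: le_trans (mus_le_lam openT (@subsetT _ E)) (lam_le1 _). Qed.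

Let mus_fin E : mus E \is a fin_num.
Proof. by rewrite ge0_fin_numE// (le_lt_trans (mus_le1 E))// ltry. Qed.

Let mus0 : mus set0 = 0%E.
Proof.
rewrite mus_open; last exact: open0.
apply/eqP; rewrite eq_le lam_ge0 andbT.
apply: ge_ereal_sup => _ [f [cf f01 fU] <-].
have -> : f = fun=> 0 by apply/funext => x; exact: fU.
by rewrite p_cst// mul0r.
Qed.

Let mus_approx E (e : R) : 0 < e ->
  exists U, [/\ open U, E `<=` U & (lam U <= mus E + e%:E)%E].
Proof.
move=> e0; have [_ [U [oU EU] <-] /ltW Ue] := lb_ereal_inf_adherent e0 (mus_fin E).
by exists U.
Qed.

(** Open supersets of the [F n], optimal up to [e / 2 ^ n.+1], reduce the claim to the subadditivity
    of [lam] on open sets. *)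
Let mus_sigma E F : subset_sigma_subadditive mus E F.
Proof.
move=> EF; apply/lee_addgt0Pr => e e0.
apply: le_trans (epsilon_trick _ _ (ltW e0)); last by move=> n; exact: mus_ge0.
have en n : 0 < e / (2 ^ n.+1)%:R by rewrite divr_gt0// ltr0n expn_gt0.
have [U UP] := choice (fun n => mus_approx (F n) (en n)).
have oU n : open (U n) by have [] := UP n.
apply: le_trans (le_trans (lam_bigcup oU) _).
  apply: mus_le_lam; first exact: bigcup_open.
  by move=> x /EF[n _ Fnx]; exists n => //; have [_ + _] := UP n; exact.
apply: lee_nneseries => [n _ _|n _]; first exact: lam_ge0.
by have [] := UP n.
Qed.

Let outer : {outer_measure set T -> \bar R} :=
  HB.pack mus (isSubsetOuterMeasure.Build R T mus mus0 mus_ge0 mus_sigma).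

(* For [f] supported in [V `&` U] the truncation [(f - e)^+] and any [g]
   supported in [V `&` [set f < e]] have disjoint supports. *)
Let open_caratheodory U : open U -> caratheodory_measurable mus U.
Proof.
move=> oU; apply: (@le_caratheodory_measurable R T outer) => X /=.
rewrite -/mus; apply: le_ereal_inf_tmp => _ [V [oV XV] <-].
have pT : 0 <= p (fun=> 1) by exact: p_ge0.
apply: (@le_trans _ _ (lam (V `&` U) + mus (X `&` ~` U))%E).
  by rewrite leeD2r// mus_le_lam//; [exact: openI|exact: setSI].
rewrite -leeBrDr//; apply: ge_ereal_sup => _ [f [cf f01 fVU] <-].
rewrite leeBrDr//; apply/lee_addgt0Pr => e e0.
pose e' := e / (p (fun=> 1) + 1).
have e'0 : 0 < e' by rewrite divr_gt0// ltr_wpDl.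
(* [X] minus [U] need not be open; its outer measure is bounded by that of the open set [W], which
   contains it because [f] vanishes on it. *)
pose W := V `&` [set x | f x < e'].
have oW : open W.
  apply: openI => //; apply: (@open_comp _ _ f [set r | r < e']);
    last exact: open_lt.
  by move=> x _; exact: cf.
apply: (@le_trans _ _ ((p f)%:E + lam W)%E).
  rewrite leeD2l// mus_le_lam// => x [Xx nUx]; split; first exact: XV.
  by rewrite /= fVU// => -[].
rewrite addeC -leeBrDr//; apply: ge_ereal_sup => _ [g [cg g01 gW] <-].
rewrite leeBrDr// -EFinD.
pose f' x := Num.max (f x - e') 0.
have cf' : continuous f'.
  move=> x; apply: (@continuous_max R T (fun x => f x - e') (fun=> 0) x).
    by apply: cvgB; [exact: cf|exact: cvg_cst].
  exact: cvg_cst.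
have f'0 x : 0 <= f' x by rewrite /f' le_max lexx orbT.
have g0 x : 0 <= g x by have /andP[] := g01 x.
have f0 x : 0 <= f x by have /andP[] := f01 x.
have ce : continuous (fun _ : T => e' : R) by move=> x; exact: cvg_cst.
have pf : p f <= e + p f'.
  apply: (@le_trans _ _ (p (fun x => e' + f' x))).
    apply: le_p => // [x|x]; first by apply: cvgD; [exact: ce|exact: cf'].
    by rewrite f0/= -lerBlDl /f' le_max lexx.
  rewrite pD// => [|x]; last exact: ltW.
  rewrite lerD2r p_cst; last exact: ltW.
  by rewrite /e' mulrAC ler_pdivrMr ?ltr_wpDl// ler_pM2l// lerDl ler01.
have tfg : test V (fun x => f' x + g x).
  split=> [x|x|x nVx].
  - by apply: cvgD; [exact: cf'|exact: cg].
  - rewrite addr_ge0//=; have [fe|ef] := ltP (f x) e'.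
      rewrite /f' max_r ?add0r; last by rewrite subr_le0 ltW.
      by have /andP[] := g01 x.
    rewrite gW ?addr0; last by move=> [_ /=]; rewrite ltNge ef.
    rewrite /f' max_l ?subr_ge0// lerBlDr (le_trans (andP (f01 x)).2)//.
    by rewrite lerDl ltW.
  - rewrite gW; last by case.
    by rewrite addr0 /f' fVU; [rewrite max_r// sub0r oppr_le0 ltW|case].
rewrite addrC; apply: (@le_trans _ _ (p (fun x => f' x + g x) + e)%:E).
  by rewrite lee_fin pD// addrAC lerD2r addrC.
by rewrite EFinD leeD2r//; apply: ereal_sup_ubound; exists (fun x => f' x + g x).
Qed.

Let mus_sigma_additive :
  semi_sigma_additive (mus : set (borel T) -> \bar R).
Proof.
have sub : (@open T).-sigma.-measurable `<=` outer.-cara.-measurable.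
  apply: smallest_sub.
    by split=> //; [move=> X mX; rewrite setTD; exact: measurableC|
      move=> F mF; exact: bigcupT_measurable].
  by move=> U oU; exact: open_caratheodory.
move=> F mF tF mUF; apply: (@caratheodory_measure_sigma_additive R T outer) => //.
- by move=> i; exact: sub.
- exact: sub.
Qed.

Let mu_meas : {measure set (borel T) -> \bar R} :=
  HB.pack (mus : set (borel T) -> \bar R)
    (isMeasure.Build _ (borel T) R mus
      mus0 mus_ge0 mus_sigma_additive).

(** Hides the packed structure: what follows sees only an abstract finite measure with the values of
    [mus]. *)
Let mu_ex : exists mu : {finite_measure set (borel T) -> \bar R},
  forall A, mu A = mus A.
Proof.
pose fin : {finite_measure set (borel T) -> \bar R} :=
  HB.pack (mus : set (borel T) -> \bar R) mu_meas
    (Measure_isFinite.Build _ (borel T) R mu_meas (fun A _ => mus_fin A)).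
by exists fin.
Qed.

Let mus_setT : mus setT = (p (fun=> 1))%:E.
Proof.
rewrite mus_open; last exact: openT.
apply/eqP; rewrite eq_le lam_le1/=; apply: ereal_sup_ubound.
exists (fun=> 1) => //; split => [//|x|x []//].
by rewrite ler01 lexx.
Qed.

(** * Comparison of the functional with the integral *)

Section integral.
Variable mu : {finite_measure set (borel T) -> \bar R}.
Hypothesis muE : forall A, mu A = mus A.

(* Slice [f] into layers of height [h]: the layer [min(f, h)] contributes at most
   [h * mu (f > 0)] to [p f] and at least [h * mu (f > h)] to the integral. *)
Let p_slice (n : nat) (f : T -> R) (h : R) : 0 < h -> continuous f ->
  (forall x, 0 <= f x <= n%:R * h) ->
  ((p f)%:E <= \int[mu]_x (f x)%:E + h%:E * mu [set x | 0 < f x]%R)%E.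
Proof.
move=> h0; elim: n f => [|n IH] f cf fn.
  rewrite (_ : f = fun=> 0); last first.
    by apply/funext => x; apply/eqP; have := fn x; rewrite mul0r eq_le andbC.
  by rewrite p_cst// mul0r integral0 add0e mule_ge0// lee_fin ltW.
have f0 x : 0 <= f x by have /andP[] := fn x.
pose f1 x := Num.min (f x) h; pose f2 x := Num.max (f x - h) 0.
have cf1 : continuous f1.
  by move=> x; apply: (@continuous_min R T f (fun=> h) x); [exact: cf|exact: cvg_cst].
have cf2 : continuous f2.
  move=> x; apply: (@continuous_max R T (fun x => f x - h) (fun=> 0) x).
    by apply: cvgB; [exact: cf|exact: cvg_cst].
  exact: cvg_cst.
have f10 x : 0 <= f1 x by rewrite /f1 le_min f0 ltW.
have f20 x : 0 <= f2 x by rewrite /f2 le_max lexx orbT.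
have f12 : f = fun x => f1 x + f2 x.
  apply/funext => x; rewrite /f1 /f2; have [fh|hf] := leP (f x) h.
    by rewrite max_r ?addr0// subr_le0.
  by rewrite max_l ?subr_ge0 1?ltW//; lra.
have pos_open (g : T -> R) : continuous g -> open [set x | 0 < g x].
  move=> cg; apply: (@open_comp _ _ g [set r | 0 < r]); last exact: open_gt.
  by move=> x _; exact: cg.
have pf1 : ((p f1)%:E <= h%:E * mu [set x | 0 < f x]%R)%E.
  rewrite muE mus_open; last exact: pos_open.
  have -> : f1 = fun x => h * (h^-1 * f1 x).
    by apply/funext => x; rewrite mulVKf// gt_eqF.
  have cf1h : continuous (fun x => h^-1 * f1 x).
    by move=> x; apply: cvgM; [exact: cvg_cst|exact: cf1].
  have hf10 x : 0 <= h^-1 * f1 x by rewrite mulr_ge0// invr_ge0 ltW.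
  rewrite pZ//; last exact: ltW.
  rewrite EFinM lee_pmul2l ?lte_fin//.
  apply: ereal_sup_ubound; eexists; last reflexivity.
  split => // x; first by rewrite hf10/= mulrC ler_pdivrMr// mul1r /f1 ge_min lexx orbT.
  move=> /negP; rewrite -leNgt => fx0.
  suff -> : f1 x = 0 by rewrite mulr0.
  by apply/eqP; rewrite eq_le f10 andbT /f1 ge_min fx0.
have mf1 := continuous_borel_EFin cf1.
have mf2 := continuous_borel_EFin cf2.
have if1 : (h%:E * mu [set x | 0 < f2 x]%R <= \int[mu]_x (f1 x)%:E)%E.
  have mD := open_borel (pos_open _ cf2).
  rewrite -integral_cst//.
  apply: (@le_trans _ _ (\int[mu]_(x in [set x | 0 < f2 x]%R) (f1 x)%:E)%E).
    apply: ge0_le_integral => //.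
    - by move=> x _; rewrite lee_fin ltW.
    - exact: measurable_funTS.
    - move=> x; rewrite /= /f2 lt_max ltxx orbF subr_gt0 => hf.
      by rewrite lee_fin /f1 le_min lexx ltW.
  apply: ge0_subset_integral => //.
  by move=> x _; rewrite lee_fin.
(* The error [h * mu (f2 > 0)] from the induction hypothesis is absorbed by the integral of [f1], so
   errors do not add up over the slices. *)
have pf2 := IH f2 cf2.
rewrite [in X in (X <= _)%E]f12 pD// EFinD.
have -> : (\int[mu]_x (f x)%:E =
    \int[mu]_x (f1 x)%:E + \int[mu]_x (f2 x)%:E)%E.
  rewrite -ge0_integralD//; first by apply: eq_integral => x _; rewrite f12.
  - by move=> x _; rewrite lee_fin.
  - by move=> x _; rewrite lee_fin.
rewrite addeC; apply: leeD => //.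
apply: le_trans (pf2 _) _.
  move=> x; rewrite f20 /f2 ge_max mulr_ge0 ?(ltW h0)// andbT lerBlDr.
  by have /andP[_] := fn x; rewrite -natr1 mulrDl mul1r.
by rewrite addeC leeD2r.
Qed.

(** The slicing error is at most [h * p 1], whatever the number of slices, so a small [h] makes it
    less than [e]. *)
Local Lemma p_le_integral (f : T -> R) : continuous f -> (forall x, 0 <= f x) ->
  ((p f)%:E <= \int[mu]_x (f x)%:E)%E.
Proof.
move=> cf f0; apply/lee_addgt0Pr => e e0.
have pT : 0 <= p (fun=> 1) by exact: p_ge0.
pose h := e / (p (fun=> 1) + 1).
have h0 : 0 < h by rewrite divr_gt0// ltr_wpDl.
have [M M0 MP] := compact_continuous_bounded cT cf.
apply: le_trans (@p_slice (Num.truncn (M / h)).+1 f h h0 cf _) _.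
  move=> x; rewrite f0/= (le_trans (ler_norm _))// (le_trans (MP x))//.
  by rewrite -ler_pdivrMr// ltW// truncnS_gt.
rewrite leeD2l//; apply: (@le_trans _ _ (h%:E * (p (fun=> 1))%:E)%E).
  by rewrite lee_pmul2l ?lte_fin//; by rewrite muE mus_le1.
by rewrite -EFinM lee_fin /h mulrAC ler_pdivrMr ?ltr_wpDl// ler_pM2l// lerDl ler01.
Qed.

End integral.

(** Slicing bounds [p f] by the integral. The reverse bound is the same inequality for [M - f],
    because [p] and the integral agree on the constant [M]. The second clause records outer
    regularity, from which regularity of the signed measure is derived. *)
Theorem riesz_positive : exists
    mu : {finite_measure set (borel T) -> \bar R},
  (forall f : T -> R, continuous f -> (forall x, 0 <= f x) ->
    (\int[mu]_x (f x)%:E)%E = (p f)%:E) /\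
  (forall (A : set T) (e : R),
    measurable (A : set (borel T)) -> 0 < e ->
    exists U, [/\ open U, A `<=` U & (mu (U `\` A) <= e%:E)%E]).
Proof.
have [mu muE] := mu_ex.
have le_int := p_le_integral muE.
exists mu; split=> [f cf f0|A e mA e0]; last first.
  have [U [oU AU Ue]] := mus_approx A e0; exists U; split => //.
  have mU := open_borel oU.
  have -> : mu (U `\` A) = (mus U - mus A)%E.
    rewrite measureD ?setIidr// -?muE// ltey_eq.
    by rewrite fin_num_measure.
  by rewrite mus_open// leeBlDr// addeC.
have [M M0 MP] := compact_continuous_bounded cT cf.
have fM x : f x <= M by rewrite (le_trans (ler_norm _)).
pose g x := M - f x.
have cg : continuous g by move=> x; apply: cvgB; [exact: cvg_cst|exact: cf].
have g0 x : 0 <= g x by rewrite subr_ge0.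
have ptot : p f + p g = M * p (fun=> 1).
  rewrite -pD// -p_cst; last exact: ltW.
  by congr p; apply/funext => x; rewrite /g addrC subrK.
have itot : (\int[mu]_x (f x)%:E + \int[mu]_x (g x)%:E =
    (p f)%:E + (p g)%:E)%E.
  rewrite -ge0_integralD//; first last.
  - exact: continuous_borel_EFin.
  - by move=> x _; rewrite lee_fin.
  - exact: continuous_borel_EFin.
  - by move=> x _; rewrite lee_fin.
  rewrite -EFinD ptot EFinM -mus_setT -muE -(integral_cst mu measurableT).
  by apply: eq_integral => x _; rewrite -EFinD /g addrC subrK.
apply/eqP; rewrite eq_le le_int// andbT.
have igfin : (\int[mu]_x (g x)%:E)%E \is a fin_num.
  exact: (integrable_fin_num measurableT (continuous_integrable mu cT cg)).
rewrite -(leeD2rE _ _ igfin) itot leeD2l//.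
exact: le_int.
Qed.

End positive_functional.

(** * Jordan decompositions and regularity *)

(** Measures can be added but not subtracted, so equalities between differences are moved to
    equalities between sums. *)
Lemma sube_eq_adde (R : realDomainType) (x y z w : \bar R) :
  x \is a fin_num -> y \is a fin_num -> z \is a fin_num -> w \is a fin_num ->
  (x - y = z - w)%E <-> (z + y = x + w)%E.
Proof.
move: x y z w => [x| |] [y| |] [z| |] [w| |]// _ _ _ _.
rewrite -!EFinB -!EFinD; split => /eqP; rewrite eqe => /eqP xyzw;
  by congr EFin; lra.
Qed.

Section jordan_decomposition_of_a_difference.
Local Open Scope ereal_scope.
Context d (T : measurableType d) (R : realType).
Variables (nu : {charge set T -> \bar R}).

Lemma jordan_plusE A : measurable A ->
  jordan_plus nu A = nu (A `&` (projT1 (cid (hahn_ex nu))).1).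
Proof.
move=> mA; rewrite [LHS](jordan_posE (hahn_choice nu)) cjordan_posE /crestr0.
by rewrite mem_set.
Qed.

Lemma jordan_minusE A : measurable A ->
  jordan_minus nu A = - nu (A `&` (projT1 (cid (hahn_ex nu))).2).
Proof.
move=> mA; rewrite [LHS](jordan_negE (hahn_choice nu)) cjordan_negE /crestr0.
by rewrite mem_set.
Qed.

Lemma jordanE A : measurable A -> nu A = jordan_plus nu A - jordan_minus nu A.
Proof.
by move=> mA; rewrite (jordan_decomp (hahn_choice nu) mA) /cadd/= cscaleN1.
Qed.

Lemma charge_total_variationE A :
  charge_total_variation nu A = jordan_plus nu A + jordan_minus nu A.
Proof. by []. Qed.

Variables m1 m2 : {finite_measure set T -> \bar R}.
Hypothesis nuE : forall A, measurable A -> nu A = m1 A - m2 A.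

(** Minimality of the Jordan decomposition: on the positive Hahn set the left side is [m1 - m2], and
    [m2] is nonnegative. *)
Lemma jordan_plus_le A : measurable A -> jordan_plus nu A <= m1 A.
Proof.
move=> mA; rewrite jordan_plusE//; set P := (X in A `&` X).
have mP : measurable P by have [[]] := hahn_choice nu.
rewrite nuE; last exact: measurableI.
rewrite (@le_trans _ _ (m1 (A `&` P)))//.
  by rewrite leeBlDr ?fin_num_measure ?leeDl//; exact: measurableI.
by rewrite le_measure ?inE//; exact: measurableI.
Qed.

Lemma jordan_minus_le A : measurable A -> jordan_minus nu A <= m2 A.
Proof.
move=> mA; rewrite jordan_minusE//; set N := (X in A `&` X).
have mN : measurable N by have [_ []] := hahn_choice nu.
have mAN : measurable (A `&` N) by exact: measurableI.
rewrite nuE// oppeB; last by rewrite fin_num_adde_defr// fin_num_measure.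
rewrite (@le_trans _ _ (m2 (A `&` N)))//.
  by rewrite addeC leeBlDr ?fin_num_measure ?leeDl.
by rewrite le_measure ?inE.
Qed.

Lemma charge_integral_difference (f : T -> R) :
  (forall m : {finite_measure set T -> \bar R},
    m.-integrable [set: T] (EFin \o f)) ->
  charge_integral nu f = \int[m1]_x (f x)%:E - \int[m2]_x (f x)%:E.
Proof.
move=> fi; have mf := measurable_int _ (fi m1).
have fin (m : {finite_measure set T -> \bar R}) : \int[m]_x (f x)%:E \is a fin_num.
  exact: (integrable_fin_num measurableT (fi m)).
(* Two decompositions of [nu] become one identity between genuine measures, which can be
   integrated. *)
have : \int[measure_add (jordan_plus nu) m2]_x (f x)%:E =
    \int[measure_add m1 (jordan_minus nu)]_x (f x)%:E.
  apply: eq_measure_integral => A mA _; rewrite [LHS]measure_addE [RHS]measure_addE.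
  by apply/sube_eq_adde; rewrite ?fin_num_measure// -jordanE// nuE.
rewrite !integral_measure_add//; [|exact: fi..].
by move/(sube_eq_adde (fin _) (fin _) (fin _) (fin _)) => h; rewrite /charge_integral h.
Qed.

End jordan_decomposition_of_a_difference.

(** * Regularity of a difference of measures and the mass of the negative part *)

Section regularity.
Context {R : realType} {T : pseudoPMetricType R}.
Hypotheses (cT : compact [set: T]) (hT : hausdorff_space T).

Lemma outer_approximation_regular (m : {measure set (borel T) -> \bar R}) :
  (forall (A : set T) (e : R), measurable (A : set (borel T)) -> 0 < e ->
    exists U, [/\ open U, A `<=` U & (m (U `\` A) <= e%:E)%E]) ->
  forall B : set T, measurable (B : set (borel T)) ->
    m B = ereal_inf [set m U | U in [set U : set T | open U /\ B `<=` U]] /\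
    m B = ereal_sup [set m K | K in [set K : set T | compact K /\ K `<=` B]].
Proof.
move=> outer B mB.
have splitm (A C : set (borel T)) : measurable A -> measurable C -> A `<=` C ->
    (m C = m (C `\` A) + m A)%E.
  by move=> mA mC AC; rewrite (measureDI m mC mA) setIidr.
split; apply/eqP; rewrite eq_le; apply/andP; split.
- apply: le_ereal_inf_tmp => _ [U [oU BU] <-].
  by rewrite le_measure// inE//; exact: open_borel.
- apply/lee_addgt0Pr => e e0; have [U [oU BU Ue]] := outer B e mB e0.
  apply: (@le_trans _ _ (m U)); first by apply: ereal_inf_lbound; exists U.
  by rewrite (splitm B U)//; [rewrite addeC leeD2l|exact: open_borel].
- apply/lee_addgt0Pr => e e0; have mC : measurable (~` B : set (borel T)).
    exact: measurableC.
  have [U [oU BU Ue]] := outer _ e mC e0.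
  have cU : closed (~` U) by exact: open_closedC.
  have UB : ~` U `<=` B by move=> x nUx; apply: contrapT => /BU.
  rewrite (splitm (~` U) B)//; last by apply: measurableC; exact: open_borel.
  rewrite addeC leeD//.
    apply: ereal_sup_ubound; exists (~` U) => //; split => //.
    by apply: subclosed_compact cT _.
  by have -> : B `\` ~` U = U `\` ~` B by rewrite !setDE !setCK setIC.
- apply: ge_ereal_sup => _ [K [cK KB] <-].
  by rewrite le_measure// inE//; apply: closed_borel; exact: compact_closed.
Qed.

(** By minimality the variation is at most [m1 + m2]. Intersecting an open superset good for [m1]
    with one good for [m2] leaves an excess of at most [e / 2] for each. *)
Lemma difference_regular (nu : {charge set (borel T) -> \bar R})
    (m1 m2 : {finite_measure set (borel T) -> \bar R}) :
  (forall A, measurable A -> nu A = m1 A - m2 A)%E ->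
  (forall (A : set T) (e : R), measurable (A : set (borel T)) -> 0 < e ->
    exists U, [/\ open U, A `<=` U & (m1 (U `\` A) <= e%:E)%E]) ->
  (forall (A : set T) (e : R), measurable (A : set (borel T)) -> 0 < e ->
    exists U, [/\ open U, A `<=` U & (m2 (U `\` A) <= e%:E)%E]) ->
  regular_charge nu.
Proof.
move=> nuE o1 o2; apply: (@outer_approximation_regular
  (charge_variation (hahn_choice nu))) => A e mA e0.
have e20 : 0 < e / 2 by rewrite divr_gt0.
have [U [oU AU Ue]] := o1 A _ mA e20; have [V [oV AV Ve]] := o2 A _ mA e20.
have oUV : open (U `&` V) by exact: openI.
exists (U `&` V); split => //; first by move=> x Ax; split; [exact: AU|exact: AV].
have mUV : measurable (U `&` V `\` A : set (borel T)).
  by apply: measurableD => //; exact: open_borel.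
have mU : measurable (U `\` A : set (borel T)).
  by apply: measurableD => //; exact: open_borel.
have mV : measurable (V `\` A : set (borel T)).
  by apply: measurableD => //; exact: open_borel.
rewrite (_ : e%:E = (e / 2)%:E + (e / 2)%:E)%E; last by rewrite -EFinD -splitr.
apply: leeD.
  apply: le_trans (jordan_plus_le nuE mUV) (le_trans _ Ue).
  by apply: le_measure; rewrite ?inE// => x [[Ux Vx] nAx]; split.
apply: le_trans (jordan_minus_le nuE mUV) (le_trans _ Ve).
by apply: le_measure; rewrite ?inE// => x [[Ux Vx] nAx]; split.
Qed.

Lemma le_integral_open (m : {finite_measure set (borel T) -> \bar R})
    (f : T -> R) (U : set T) : continuous f -> open U ->
  (forall x, 0 <= f x <= 1) -> (forall x, ~ U x -> f x = 0) ->
  (\int[m]_x (f x)%:E <= m U)%E.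
Proof.
move=> cf oU f01 fU; have mU := open_borel oU.
have -> : m U = (\int[m]_x (\1_U x)%:E)%E by rewrite integral_indic// setIT.
apply: ge0_le_integral => //.
- by move=> x _; rewrite lee_fin; have /andP[] := f01 x.
- exact: continuous_borel_EFin.
- by apply/measurable_EFinP; exact: measurable_indic.
- move=> x _; rewrite lee_fin indicE; have [Ux|nUx] := pselect (U x).
    by rewrite mem_set//; have /andP[] := f01 x.
  by rewrite fU// memNset.
Qed.

Lemma ge_integral_closed (m : {finite_measure set (borel T) -> \bar R})
    (f : T -> R) (K : set T) : continuous f -> closed K ->
  (forall x, 0 <= f x <= 1) -> (forall x, K x -> f x = 1) ->
  (m K <= \int[m]_x (f x)%:E)%E.
Proof.
move=> cf cK f01 fK; have mK := closed_borel cK.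
have -> : m K = (\int[m]_x (\1_K x)%:E)%E by rewrite integral_indic// setIT.
apply: ge0_le_integral => //.
- by apply/measurable_EFinP; exact: measurable_indic.
- exact: continuous_borel_EFin.
- move=> x _; rewrite lee_fin indicE; have [Kx|nKx] := pselect (K x).
    by rewrite mem_set// fK.
  by rewrite memNset//; have /andP[] := f01 x.
Qed.

(* On the negative Hahn set [jordan_plus] vanishes and [jordan_minus] has full
   mass; regularity allows to replace its indicator by a continuous function. *)
Lemma jordan_minus_sup (nu : {charge set (borel T) -> \bar R}) :
  regular_charge nu ->
  jordan_minus nu [set: T] = ereal_sup [set (- charge_integral nu f)%E | f in
    [set f : T -> R | continuous f /\ forall x, 0 <= f x <= 1]].
Proof.
move=> rnu; have fin (m : {finite_measure set (borel T) -> \bar R}) (f : T -> R) :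
    continuous f -> (\int[m]_x (f x)%:E)%E \is a fin_num.
  by move=> cf; exact: (integrable_fin_num measurableT (continuous_integrable m cT cf)).
have opp_integral (f : T -> R) : continuous f -> (- charge_integral nu f =
    \int[jordan_minus nu]_x (f x)%:E - \int[jordan_plus nu]_x (f x)%:E)%E.
  by move=> cf; rewrite /charge_integral oppeB ?fin_num_adde_defr ?fin// addeC.
apply/eqP; rewrite eq_le; apply/andP; split; last first.
  apply: ge_ereal_sup => _ [f [cf f01] <-]; rewrite opp_integral//.
  rewrite leeBlDr ?fin//; apply: (@le_trans _ _ (jordan_minus nu setT)).
    by apply: (le_integral_open _ cf openT f01) => x [].
  rewrite leeDl// integral_ge0// => x _; rewrite lee_fin.
  by have /andP[] := f01 x.
set N := (projT1 (cid (hahn_ex nu))).2.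
have [[mP _] [mN _] PNT PN0] := hahn_choice nu.
have NP : N `&` (projT1 (cid (hahn_ex nu))).1 = set0 by rewrite setIC.
have jpN : jordan_plus nu N = 0%E by rewrite jordan_plusE// NP charge0.
have jmN : jordan_minus nu N = jordan_minus nu setT.
  by rewrite !jordan_minusE// setTI setIid.
have vN : charge_total_variation nu N = jordan_minus nu setT.
  by rewrite charge_total_variationE jpN add0e.
have jfin : jordan_minus nu setT \is a fin_num by rewrite fin_num_measure.
have [infN supN] := rnu N mN.
apply/lee_addgt0Pr => e e0.
have e20 : 0 < e / 2 by rewrite divr_gt0.
have [_ [U [oU NU] <-] Ue] : exists2 y, [set charge_total_variation nu U | U in
    [set U : set T | open U /\ N `<=` U]] y &
    (y < jordan_minus nu setT + (e / 2)%:E)%E.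
  by rewrite -vN infN; apply: lb_ereal_inf_adherent => //; rewrite -infN vN.
have [_ [K [cK KN] <-] Ke] : exists2 y, [set charge_total_variation nu K | K in
    [set K : set T | compact K /\ K `<=` N]] y &
    (jordan_minus nu setT - (e / 2)%:E < y)%E.
  by rewrite -vN supN; apply: ub_ereal_sup_adherent => //; rewrite -supN vN.
have clK : closed K by exact: compact_closed.
have [mK mU] := (closed_borel clK, open_borel oU).
have [f [cf f01 fK fU]] := closed_open_bump clK oU (subset_trans KN NU).
(* [K] lies in [N], where [jordan_plus] vanishes, so the variation of [K] is its [jordan_minus]
   mass. *)
have Kle : (jordan_minus nu setT - (e / 2)%:E <= \int[jordan_minus nu]_x (f x)%:E)%E.
  apply: le_trans (ge_integral_closed _ cf clK f01 fK).
  apply: le_trans (ltW Ke) _; rewrite charge_total_variationE.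
  rewrite (_ : jordan_plus nu K = 0%E) ?add0e//.
  apply/eqP; rewrite eq_le measure_ge0 andbT -jpN.
  by rewrite le_measure ?inE.
(* [U] contains [N], which already carries all the mass of [jordan_minus]; an excess variation below
   [e / 2] therefore bounds [jordan_plus nu U]. *)
have Ule : (\int[jordan_plus nu]_x (f x)%:E <= (e / 2)%:E)%E.
  apply: le_trans (le_integral_open _ cf oU f01 fU) _.
  rewrite -(leeD2lE _ _ jfin); apply: le_trans (ltW Ue).
  rewrite charge_total_variationE addeC leeD2l// -jmN.
  by rewrite le_measure ?inE.
apply: (@le_trans _ _ (- charge_integral nu f + e%:E)%E); last first.
  by rewrite leeD2r//; apply: ereal_sup_ubound; exists f.
rewrite opp_integral//.
have := fin (jordan_minus nu) f cf; have := fin (jordan_plus nu) f cf.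
move: Kle Ule jfin; move: (jordan_minus nu setT) (\int[jordan_minus nu]_x _)%E
  (\int[jordan_plus nu]_x _)%E => [a| |] [b| |] [c| |]//.
rewrite -!EFinB -!EFinD !lee_fin => ab ce _ _ _; lra.
Qed.

End regularity.

(** * The Riesz-Markov theorem for bounded functionals *)

Section riesz_markov.
Context {R : realType} {T : pseudoPMetricType R}.
Hypotheses (cT : compact [set: T]) (hT : hausdorff_space T).
Variable L : (T -> R) -> R.
Hypothesis LD : forall f g : T -> R, continuous f -> continuous g ->
  L (fun x => f x + g x) = L f + L g.
Hypothesis LZ : forall (c : R) (f : T -> R), continuous f ->
  L (fun x => c * f x) = c * L f.
Hypothesis L_bounded : exists M : R, forall f : T -> R, continuous f ->
  (forall x, `|f x| <= 1) -> `|L f| <= M.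

Let minorants (f : T -> R) : set (T -> R) :=
  [set g : T -> R | continuous g /\ forall x, 0 <= g x <= f x].

Let pos (f : T -> R) : R := sup [set L g | g in minorants f].

Let L0 : L (fun=> 0) = 0.
Proof.
have c1 : continuous (fun _ : T => 1 : R) by move=> x; exact: cvg_cst.
by have := LZ 0 c1; under eq_fun do rewrite mul0r; rewrite mul0r.
Qed.

Let minorants0 (f : T -> R) : (forall x, 0 <= f x) -> minorants f (fun=> 0).
Proof. by move=> f0; split=> [x|x]; [exact: cvg_cst|rewrite lexx f0]. Qed.

(** Every minorant of [f] is bounded by [B], so dividing by [B] brings it into the unit ball, where
    [L] is bounded. *)
Let minorants_has_sup (f : T -> R) : continuous f -> (forall x, 0 <= f x) ->
  has_sup [set L g | g in minorants f].
Proof.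
move=> cf f0; split; first by exists (L (fun=> 0)), (fun=> 0) => //; exact: minorants0.
have [M MP] := L_bounded; have [B B0 BP] := compact_continuous_bounded cT cf.
exists (B * M) => _ [g [cg gf] <-].
have cBg : continuous (fun x => B^-1 * g x).
  by move=> x; apply: cvgM; [exact: cvg_cst|exact: cg].
have -> : g = fun x => B * (B^-1 * g x).
  by apply/funext => x; rewrite mulVKf// gt_eqF.
rewrite LZ// ler_pM2l// (le_trans (ler_norm _))// MP// => x.
have /andP[g0 gfx] := gf x.
have Bg0 : 0 <= B^-1 * g x by rewrite mulr_ge0// invr_ge0 ltW.
rewrite ger0_norm// mulrC ler_pdivrMr// mul1r.
by rewrite (le_trans gfx)// (le_trans (ler_norm _)).
Qed.

Let pos_ub (f g : T -> R) : continuous f -> (forall x, 0 <= f x) -> minorants f g ->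
  L g <= pos f.
Proof.
move=> cf f0 fg; apply: sup_upper_bound; first exact: minorants_has_sup.
by exists g.
Qed.

Let pos_le (f : T -> R) (M : R) : (forall x, 0 <= f x) ->
  (forall g, minorants f g -> L g <= M) -> pos f <= M.
Proof.
move=> f0 fM; apply: ge_sup; last by move=> _ [g fg <-]; exact: fM.
by exists (L (fun=> 0)), (fun=> 0) => //; exact: minorants0.
Qed.

Let pos_ge0 (f : T -> R) : continuous f -> (forall x, 0 <= f x) -> 0 <= pos f.
Proof. by move=> cf f0; rewrite -L0 pos_ub//; exact: minorants0. Qed.

Let L_le_pos (f : T -> R) : continuous f -> (forall x, 0 <= f x) -> L f <= pos f.
Proof. by move=> cf f0; rewrite pos_ub//; split => // x; rewrite f0 lexx. Qed.

(* Riesz decomposition: a minorant [h] of [f + g] splits as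
   [min(h, f) + (h - min(h, f))]. *)
Let posD (f g : T -> R) : continuous f -> continuous g ->
  (forall x, 0 <= f x) -> (forall x, 0 <= g x) ->
  pos (fun x => f x + g x) = pos f + pos g.
Proof.
move=> cf cg f0 g0.
have cfg : continuous (fun x => f x + g x).
  by move=> x; apply: cvgD; [exact: cf|exact: cg].
have fg0 x : 0 <= f x + g x by rewrite addr_ge0.
apply/eqP; rewrite eq_le; apply/andP; split.
  apply: pos_le => // h [ch hfg].
  pose k x := Num.min (h x) (f x).
  have ck : continuous k.
    by move=> x; apply: (@continuous_min R T h f x); [exact: ch|exact: cf].
  have chk : continuous (fun x => h x - k x).
    by move=> x; apply: cvgB; [exact: ch|exact: ck].
  have -> : h = fun x => k x + (h x - k x) by apply/funext => x; lra.
  rewrite LD// lerD// pos_ub//; split => // x; have /andP[h0 hx] := hfg x.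
    by rewrite /k le_min h0 f0 ge_min lexx orbT.
  rewrite subr_ge0 {1}/k ge_min lexx/= lerBlDr /k.
  by have [_|_] := leP (h x) (f x); [rewrite lerDr|rewrite addrC].
rewrite -lerBrDr; apply: pos_le => // h [ch hf].
rewrite lerBrDr -lerBrDl; apply: pos_le => // k [ck kg].
rewrite lerBrDl -LD// pos_ub//; split=> [x|x].
  by apply: cvgD; [exact: ch|exact: ck].
by have /andP[h0 hx] := hf x; have /andP[k0 kx] := kg x; rewrite addr_ge0// lerD.
Qed.

Let posZ (c : R) (f : T -> R) : 0 <= c -> continuous f ->
  (forall x, 0 <= f x) -> pos (fun x => c * f x) = c * pos f.
Proof.
have cM (a : R) (h : T -> R) : continuous h -> continuous (fun x => a * h x).
  by move=> ch x; apply: cvgM; [exact: cvg_cst|exact: ch].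
(* One inequality for every positive factor suffices: used with [c^-1] it yields the reverse one for
   [c]. *)
have le (a : R) (h : T -> R) : 0 < a -> continuous h -> (forall x, 0 <= h x) ->
    a * pos h <= pos (fun x => a * h x).
  move=> a0 ch h0; rewrite mulrC -ler_pdivlMr//.
  apply: pos_le => // g [cg gh]; rewrite ler_pdivlMr// mulrC -LZ//.
  rewrite pos_ub//; first exact: cM; first by move=> x; rewrite mulr_ge0// ltW.
  split; first exact: cM.
  move=> x; have /andP[g0 gx] := gh x.
  by rewrite mulr_ge0 ?(ltW a0)//= ler_pM2l.
rewrite le_eqVlt => /predU1P[<-|c0] cf f0.
  rewrite mul0r; under eq_fun do rewrite mul0r.
  apply/eqP; rewrite eq_le pos_ge0// ?andbT; last by move=> x; exact: cvg_cst.
  apply: pos_le => // g [cg g0]; rewrite (_ : g = fun=> 0) ?L0//.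
  by apply/funext => x; apply/eqP; rewrite eq_le andbC.
apply/eqP; rewrite eq_le le// andbT -ler_pdivrMl//.
apply: le_trans (le c^-1 _ _ _ _) _; rewrite ?invr_gt0//; first exact: cM.
  by move=> x; rewrite mulr_ge0// ltW.
by under eq_fun do rewrite mulKf ?gt_eqF//.
Qed.

(** The negative part is [pos f - L f]. It is nonnegative because a nonnegative [f] is one of its
    own minorants. *)
Theorem riesz_markov : exists2 nu : {charge set (borel T) -> \bar R},
  regular_charge nu &
  forall f : T -> R, continuous f -> (L f)%:E = charge_integral nu f.
Proof.
have [m1 [m1E m1o]] := riesz_positive cT posD posZ pos_ge0.
have negD (f g : T -> R) : continuous f -> continuous g ->
    (forall x, 0 <= f x) -> (forall x, 0 <= g x) ->
    pos (fun x => f x + g x) - L (fun x => f x + g x) =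
    (pos f - L f) + (pos g - L g).
  by move=> cf cg f0 g0; rewrite posD// LD//; lra.
have negZ (c : R) (f : T -> R) : 0 <= c -> continuous f ->
    (forall x, 0 <= f x) ->
    pos (fun x => c * f x) - L (fun x => c * f x) = c * (pos f - L f).
  by move=> c0 cf f0; rewrite posZ// LZ// mulrBr.
have neg_ge0 (f : T -> R) : continuous f -> (forall x, 0 <= f x) ->
    0 <= pos f - L f.
  by move=> cf f0; rewrite subr_ge0 L_le_pos.
have [m2 [m2E m2o]] := @riesz_positive _ _ cT (fun f => pos f - L f) negD negZ neg_ge0.
pose nu : {charge set (borel T) -> \bar R} :=
  cadd (charge_of_finite_measure m1) (cscale (-1) (charge_of_finite_measure m2)).
have nuE A : measurable A -> (nu A = m1 A - m2 A)%E.
  by move=> mA; transitivity (m1 A + (-1)%:E * m2 A)%E; rewrite// EFinN mulN1e.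
exists nu; first exact: difference_regular nuE m1o m2o.
move=> f cf; rewrite (charge_integral_difference nuE); last first.
  by move=> m; exact: continuous_integrable.
have [B B0 BP] := compact_continuous_bounded cT cf.
(* [m1] and [m2] represent their functionals on nonnegative functions only; [f] is shifted by its
   bound [B] and the constant is subtracted again. *)
pose fB x := f x + B.
have cB : continuous (fun _ : T => B : R) by move=> x; exact: cvg_cst.
have cfB : continuous fB by move=> x; apply: cvgD; [exact: cf|exact: cvg_cst].
have fB0 x : 0 <= fB x by have := BP x; rewrite ler_norml /fB; lra.
have B0x (x : T) : 0 <= B by exact: ltW.
have split_int (m : {finite_measure set (borel T) -> \bar R}) :
    (\int[m]_x (fB x)%:E = \int[m]_x (f x)%:E + \int[m]_x B%:E)%E.
  have fi := continuous_integrable m cT cf; have Bi := continuous_integrable m cT cB.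
  by rewrite -(integralD measurableT fi Bi); apply: eq_integral.
have := split_int m1; have := split_int m2.
rewrite (m1E fB)// (m1E (fun=> B))// (m2E fB)// (m2E (fun=> B))// LD//.
have : (\int[m1]_x (f x)%:E)%E \is a fin_num.
  exact: (integrable_fin_num measurableT (continuous_integrable m1 cT cf)).
have : (\int[m2]_x (f x)%:E)%E \is a fin_num.
  exact: (integrable_fin_num measurableT (continuous_integrable m2 cT cf)).
move: (\int[m1]_x _)%E (\int[m2]_x _)%E => [a| |] [b| |]// _ _.
rewrite -!EFinD => -[] e2 [] e1; congr EFin.
by clear B0x; lra.
Qed.

End riesz_markov.

(** * Positivity loss *)

Lemma sphere_hausdorff (R : realType) (d : nat) : hausdorff_space (sphere R d).
Proof.
move=> p q pq; apply: val_inj; apply: norm_hausdorff => A B pA qB.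
have vc : continuous (\val : sphere R d -> 'rV[R]_d.+1).
  exact: initial_continuous.
by have [z [Az Bz]] := pq _ _ (vc p _ pA) (vc q _ qB); exists (\val z).
Qed.

Section positivity_loss.
Context {R : realType} {d : nat}.
Variable A : {linear csphere R d -> csphere R d}.
Hypothesis A_bounded : bounded_operator A.
Hypothesis A1 : A (csphere_cst d 1) = csphere_cst d 1.

Let unit_functions : set (csphere R d) :=
  [set f : csphere R d | forall y, 0 <= f y <= 1].

(** Extension by 0 to discontinuous functions turns [A] at a point into a functional on all
    functions, the form that [riesz_markov] expects. *)
Let cs (h : sphere R d -> R) : csphere R d :=
  if pselect (continuous h) is left ch then csphere_of ch else 0.

Let csE (h : sphere R d -> R) : continuous h -> cs h = h :> (sphere R d -> R).
Proof. by move=> ch; rewrite /cs; case: pselect. Qed.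

Let cs_id (f : csphere R d) : cs f = f.
Proof. by apply/csphereP => x; rewrite csE//; exact: csphere_continuous. Qed.

(** Existence of one representing charge is what makes [xget] return such a charge instead of its
    default. *)
Lemma riesz_charge_represents x :
  represents (fun f => A f x) (riesz_charge A x).
Proof.
suff : exists nu, represents (fun f => A f x) nu by exact: xgetPex.
have [||| nu rnu nuE] := @riesz_markov R (sphere R d) (@sphere_compact R d)
    (@sphere_hausdorff R d) (fun h => A (cs h) x).
- move=> f g cf cg; rewrite -csphere_addE -linearD; congr (A _ x).
  apply/csphereP => y; rewrite csphere_addE !csE//.
  by move=> z; exact: (cvgD (cf z) (cg z)).
- move=> c f cf; rewrite -csphere_scaleE -linearZ; congr (A _ x).
  apply/csphereP => y; rewrite csphere_scaleE !csE//.
  by move=> z; exact: (cvgM (cvg_cst c) (cf z)).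
(* The absolute value is taken because the bound [M] is not assumed nonnegative. *)
- have [M MP] := A_bounded; exists `|M| => f cf f1.
  apply: le_trans (csphere_norm_ub _ x) _; apply: le_trans (MP _) _.
  rewrite (le_trans (ler_wpM2r _ (ler_norm M)))// ler_piMr//.
  by apply: csphere_norm_le => y; rewrite csE.
exists nu; split=> // f; rewrite -nuE ?cs_id//; exact: csphere_continuous.
Qed.

Lemma jordan_minus_riesz_charge x :
  jordan_minus (riesz_charge A x) setT =
  ereal_sup [set (- A f x)%:E | f in unit_functions].
Proof.
have [rnu nuE] := riesz_charge_represents x.
rewrite (jordan_minus_sup (@sphere_compact R d) (@sphere_hausdorff R d) rnu).
congr ereal_sup; apply/seteqP; split=> [_ [f [cf f01] <-]|_ [f f01 <-]].
  exists (cs f); first by move=> y; rewrite csE.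
  by rewrite EFinN nuE csE.
exists f; first by split => //; exact: csphere_continuous.
by rewrite EFinN nuE.
Qed.

Lemma positivity_loss_supN : positivity_loss A = ereal_sup
  [set (- A f x)%:E | x in [set: sphere R d] & f in unit_functions].
Proof.
apply/eqP; rewrite eq_le; apply/andP; split; apply: ge_ereal_sup.
  move=> _ [x _ <-]; rewrite jordan_minus_riesz_charge.
  apply: ge_ereal_sup => _ [f f01 <-]; apply: ereal_sup_ubound.
  by exists x => //; exists f.
move=> _ [x _ [f f01 <-]].
apply: (@le_trans _ _ (jordan_minus (riesz_charge A x) setT)).
  by rewrite jordan_minus_riesz_charge; apply: ereal_sup_ubound; exists f.
by apply: ereal_sup_ubound; exists x.
Qed.

Let flip (f : csphere R d) := csphere_cst d 1 - f.

Let flip_unit f : unit_functions f -> unit_functions (flip f).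
Proof.
move=> f01 y; rewrite csphere_addE csphere_oppE csphere_cstE.
by have := f01 y; lra.
Qed.

Let A_flip f x : A (flip f) x = 1 - A f x.
Proof. by rewrite linearB A1 csphere_addE csphere_oppE. Qed.

Lemma positivity_loss_sup : positivity_loss A = ereal_sup
  [set (A f x - 1)%:E | x in [set: sphere R d] & f in unit_functions].
Proof.
rewrite positivity_loss_supN; congr ereal_sup.
by apply/seteqP; split => _ [x _ [f f01 <-]]; exists x => //; exists (flip f);
  rewrite ?A_flip//; [exact: flip_unit| |exact: flip_unit|]; congr EFin; lra.
Qed.

Lemma positivity_loss_ge0 : (0 <= positivity_loss A)%E.
Proof.
rewrite positivity_loss_supN; apply: ereal_sup_ubound.
exists point => //; exists 0; first by move=> y; rewrite lexx ler01.
by rewrite linear0 oppr0.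
Qed.

Lemma opnorm_positivity_loss : opnorm A = (1 + 2%:E * positivity_loss A)%E.
Proof.
have Afx f x (o : R) : `|A f| <= o -> A f x <= o.
  by apply: le_trans; exact: le_trans (ler_norm _) (csphere_norm_ub _ x).
apply/eqP; rewrite eq_le; apply/andP; split.
  apply: ge_ereal_sup => _ [f /= f1 <-].
  have := positivity_loss_ge0; case: (positivity_loss A) positivity_loss_sup => [r| |]//.
    move=> rE _; rewrite -EFinM -EFinD lee_fin; apply: csphere_norm_le => x.
    have ub (g : csphere R d) : `|g| <= 1 -> A g x <= 1 + 2 * r.
      (* The inverse of the substitution [g = 1 - 2 f], up to a flip: it maps the unit ball into the
         functions between 0 and 1, and [A h x - 1 <= r] reads [A g x <= 1 + 2 * r]. *)
      move=> g1; pose h := 2^-1 *: (csphere_cst d 1 + g).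
      have h01 : unit_functions h.
        move=> y; rewrite csphere_scaleE csphere_addE csphere_cstE.
        have := le_trans (csphere_norm_ub g y) g1; rewrite ler_norml; lra.
      have : ((A h x - 1)%:E <= r%:E)%E.
        by rewrite rE; apply: ereal_sup_ubound; exists x => //; exists h.
      rewrite lee_fin /h linearZ csphere_scaleE linearD csphere_addE A1 csphere_cstE.
      lra.
    rewrite ler_norml ub// andbT lerNl.
    by have := ub (- f); rewrite normrN linearN csphere_oppE; exact.
  (* An infinite loss makes the upper bound trivial. *)
  by move=> _ _; rewrite gt0_muley// addey// leey.
rewrite addeC -leeBrDr// -lee_pdivlMl// positivity_loss_supN.
apply: ge_ereal_sup => _ [x _ [f f01 <-]].
rewrite lee_pdivlMl// leeBrDr//.
pose g := csphere_cst d 1 - 2 *: f.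
have g1 : `|g| <= 1.
  apply: csphere_norm_le => y.
  rewrite csphere_addE csphere_oppE csphere_scaleE csphere_cstE ler_norml.
  by have := f01 y; lra.
apply: (@le_trans _ _ `|A g|%:E); last by apply: ereal_sup_ubound; exists g.
rewrite -EFinM -EFinD lee_fin; have := Afx g x _ (lexx _).
rewrite linearB csphere_addE csphere_oppE A1 linearZ csphere_scaleE csphere_cstE.
lra.
Qed.

Lemma opnorm_eq1 : opnorm A = 1%E <-> positive_operator A.
Proof.
rewrite opnorm_positivity_loss; split=> [p0 f f0 x|posA].
  have loss0 : positivity_loss A = 0%E.
    have := positivity_loss_ge0; case: (positivity_loss A) p0 => [r| |]//.
      by rewrite -EFinM -EFinD => -[r0] _; congr EFin; lra.
    by rewrite gt0_muley// addey.
  (* Scaling by [b] brings a nonnegative [f] between 0 and 1; the [+ 1] allows [f = 0]. *)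
  pose b := `|f| + 1; have b0 : 0 < b by rewrite ltr_wpDl.
  pose g := b^-1 *: f.
  have g01 : unit_functions g.
    move=> y; rewrite csphere_scaleE mulr_ge0 ?invr_ge0 ?(ltW b0)//=.
    rewrite mulrC ler_pdivrMr// mul1r (le_trans (ler_norm _))//.
    by rewrite (le_trans (csphere_norm_ub f y))// lerDl.
  have : ((- A g x)%:E <= 0)%E.
    rewrite -loss0 positivity_loss_supN; apply: ereal_sup_ubound.
    by exists x => //; exists g.
  by rewrite lee_fin oppr_le0 linearZ csphere_scaleE pmulr_rge0// invr_gt0.
suff -> : positivity_loss A = 0%E by rewrite mule0 adde0.
apply/eqP; rewrite eq_le positivity_loss_ge0 andbT positivity_loss_supN.
apply: ge_ereal_sup => _ [x _ [f f01 <-]]; rewrite lee_fin oppr_le0.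
by apply: posA => y; have /andP[] := f01 y.
Qed.

End positivity_loss.

Theorem proposition1p2 (R : realType) (d : nat) (d_ge1 : (1 <= d)%N)
    (A : {linear csphere R d -> csphere R d})
    (A_bounded : bounded_operator A)
    (A1 : A (csphere_cst d 1) = csphere_cst d 1) :
  [/\ opnorm A = (1 + 2%:E * positivity_loss A)%E,
      positivity_loss A = ereal_sup
        [set (A f x - 1)%:E | x in [set: sphere R d] &
          f in [set f : csphere R d | forall y, 0 <= f y <= 1]],
      positivity_loss A = ereal_sup
        [set (- A f x)%:E | x in [set: sphere R d] &
          f in [set f : csphere R d | forall y, 0 <= f y <= 1]],
      (1 <= opnorm A)%E &
      opnorm A = 1%E <-> positive_operator A].
Proof.
split.
- exact: opnorm_positivity_loss.
- exact: positivity_loss_sup.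
- exact: positivity_loss_supN.
- rewrite opnorm_positivity_loss// leeDl// mule_ge0//.
  exact: positivity_loss_ge0.
- exact: opnorm_eq1.
Qed.
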